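(* Consider any hash-based, order-invariant distinct counting sketch, let $\epsilon>0$, and let $k_{max}$ be such that $k_{max}\ge K_r$ for all input streams and all $r$. The sketch output by the algorithm satisfies $\epsilon$-DP if $\sup_{s\in\Omega}\pi(s)<\pi_0:=1-e^{-\epsilon}$ and the stream contains strictly more than $n_0:=k_{max}/(1-e^{-\epsilon})$ distinct items.
   Context: Let $U$ be a universe of items. A randomized distinct counting sketching algorithm has internal randomness $r$, which specifies a uniformly random hash function $h$ on $U$; run on a data set (stream) $\mathcal D$ it produces a sketch state $S_r(\mathcal D)$ in a set $\Omega$ of states. The algorithm is hash-based and order-invariant if $S_r(\mathcal D)$ depends only on the set of hash values $\{h(x):x\in\mathcal D\}$. Probabilities are over $r$. For $i\in\mathcal D$, $\mathcal D_{-i}=\mathcal D\setminus\{i\}$; $\mathcal K_r=\{i\in\mathcal D: S_r(\mathcal D_{-i})\neq S_r(\mathcal D)\}$ and $K_r=|\mathcal K_r|$. For a state $s$, $\pi(s)=\Pr_r\big(S_r(\mathcal D)\neq S_r(\mathcal D_{-i})\mid S_r(\mathcal D_{-i})=s\big)$, the probability that inserting a new, previously unseen item into a sketch in state $s$ changes it. The sketch run on streams of cardinality $n$ satisfies $\epsilon$-DP if for every data set $\mathcal D$ of $n$ distinct items, every $i\in\mathcal D$ and every $s\in\Omega$: $e^{-\epsilon}<\Pr_r(S_r(\mathcal D)=s)/\Pr_r(S_r(\mathcal D_{-i})=s)<e^{\epsilon}$. *)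

(* Defs.v *)
From HB Require Import structures.
From mathcomp Require Import all_boot all_order all_algebra.
From mathcomp Require Import boolp classical_sets reals ereal sequences exp.
From mathcomp Require Import measure random_variable.

Set Implicit Arguments.
Unset Strict Implicit.
Unset Printing Implicit Defensive.

Import Order.TTheory GRing.Theory Num.Theory.

Local Open Scope classical_set_scope.
Local Open Scope ring_scope.

(* A stream may repeat items, so removing an item removes every occurrence. *)
Definition remove_item (U : eqType) (i : U) (D : seq U) : seq U :=
  [seq x <- D | x != i].

Definition num_distinct (U : eqType) (D : seq U) : nat := size (undup D).

Section Sketch.
Context {R : realType} {d dH : measure_display}.
Context {T : measurableType d} {H : measurableType dH}.
Context {U : eqType} {Omega : Type}.
Variable P : probability T R.

(* A uniformly random function U -> H: the values at distinct items are
   mutually independent and each is uniform on H.  Uniformity is relative to a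
   reference measure nu: counting measure on a finite range, Lebesgue measure
   on [0, 1], the coin-flipping measure on infinite bit strings, etc. *)
Definition uniform_hash (nu : {measure set H -> \bar R})
    (h : U -> {RV P >-> H}) : Prop :=
  [/\ (0 < nu [set: H] < +oo)%E,
      forall (x : U) (B : set H), measurable B ->
        P (h x @^-1` B) = (nu B * (fine (nu [set: H]))^-1%:E)%E
    & forall (s : seq U) (B : U -> set H), uniq s ->
        (forall x, measurable (B x)) ->
        P [set r | forall x, x \in s -> B x (h x r)] =
        (\prod_(x <- s) P (h x @^-1` B x))%E].

(* The state is a function F of the set of hash values, the same F for every r.
   The first conjunct is the regularity needed to speak of probabilities of
   states: F is measurable, state by state, in any finite vector of hash
   values; it is automatic when H is finite and discrete. *)
Definition hash_based_order_invariant (h : U -> {RV P >-> H})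
    (S : T -> seq U -> Omega) : Prop :=
  exists F : set H -> Omega,
    (forall (m : nat) (s : Omega),
        measurable [set v : m.-tuple H | F [set` v] = s]) /\
    (forall (r : T) (D : seq U), S r D = F [set h x r | x in [set` D]]).

Variable S : T -> seq U -> Omega.

Definition changing_items (D : seq U) (r : T) : seq U :=
  [seq i <- undup D | `[< S r (remove_item i D) <> S r D >] ].

Definition num_changing (D : seq U) (r : T) : nat := size (changing_items D r).

(* Pr(S_r(D) <> S_r(D_{-i}) | S_r(D_{-i}) = s).  When the conditioning event is
   null this is 0 (division by zero), which cannot affect the supremum over s
   of these nonnegative numbers. *)
Definition change_prob (D : seq U) (i : U) (s : Omega) : R :=
  fine (P [set r | S r D <> S r (remove_item i D) /\ S r (remove_item i D) = s])
  / fine (P [set r | S r (remove_item i D) = s]).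

(* States of probability 0 under both D and D_{-i}, whose ratio would be 0/0,
   are skipped.  If exactly one of p, q is 0 then p / q = 0 (also for q = 0, by
   the division convention) and the lower bound fails, as it should. *)
Definition eps_DP (n : nat) (eps : R) : Prop :=
  forall (D : seq U) (i : U) (s : Omega),
    num_distinct D = n -> i \in D ->
    let p := fine (P [set r | S r D = s]) in
    let q := fine (P [set r | S r (remove_item i D) = s]) in
    (p != 0) || (q != 0) -> expR (- eps) < p / q < expR eps.

End Sketch.

(* Main.v *)
(* Write p, q for the probabilities of state s on D and on D_{-i}, and c for the
   probability that both sketches are in state s.  Since a fraction at most
   pi(s) of q is lost when i is inserted, p >= c >= q (1 - pi(s)).
   Conversely, hash values of distinct items are exchangeable, so
   Pr(S(D) = s, j in K) does not depend on j in D; summing over j gives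
   n Pr(S(D) = s, i in K) = E[K; S(D) = s] <= kmax p, whence
   q >= c >= p (1 - kmax / n). *)
Require Import Defs.
From HB Require Import structures.
From mathcomp Require Import all_boot all_order all_algebra.
From mathcomp Require Import boolp classical_sets reals ereal sequences exp.
From mathcomp Require Import measure random_variable.
From mathcomp Require Import numfun measurable_realfun lebesgue_integral.
From mathcomp Require Import lra.

Set Implicit Arguments.
Unset Strict Implicit.
Unset Printing Implicit Defensive.

Import Order.TTheory GRing.Theory Num.Theory.
Local Open Scope classical_set_scope.
Local Open Scope ring_scope.

Lemma num_distinct_gt0 (U : eqType) (x : U) (D : seq U) :
  x \in D -> (0 < num_distinct D)%N.
Proof. by rewrite /num_distinct -mem_undup; case: (undup D). Qed.

(** * Measure-theoretic preliminaries: rectangles of tuples and sums of events *)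

Definition tuple_rect (H : Type) (n : nat) (B : 'I_n -> set H) :
    set (n.-tuple H) :=
  [set v | forall i, B i (tnth v i)].

Definition tuple_rects d (H : measurableType d) (n : nat) :
    set (set (n.-tuple H)) :=
  [set tuple_rect B | B in [set B | forall i, measurable (B i)]].

(** A one-coordinate cylinder is a rectangle whose other sides are full, and a rectangle is a finite
    intersection of cylinders. Rectangles thus form a generating pi-system, on which laws of tuples
    can be compared. *)
Lemma measurable_tuple_rects d (H : measurableType d) (n : nat) :
  @measurable _ (n.-tuple H) = <<s @tuple_rects d H n >>.
Proof.
apply/seteqP; split.
- apply: smallest_sub; first exact: smallest_sigma_algebra.
  move=> A; rewrite -bigcup_seq => -[i _ [B mB <-]].
  apply: sub_sigma_algebra.
  exists (fun j => if j == i then B else setT).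
    by move=> j /=; case: ifP.
  apply/seteqP; split => v /=; rewrite /tuple_rect /=.
    by move=> /(_ i); rewrite eqxx.
  by move=> [_ Bv] j; case: eqP => [->|].
- apply: smallest_sub; first exact: sigma_algebra_measurable.
  move=> _ [B mB <-].
  rewrite (_ : tuple_rect B =
      \big[setI/setT]_(i < n) ((@tnth n H ^~ i) @^-1` B i)).
    apply: bigsetI_measurable => i _; rewrite -[X in measurable X]setTI.
    exact: measurable_tnth.
  rewrite -bigcap_seq; apply/seteqP; split => v /= Bv i.
    by move=> _; exact: Bv.
  by apply: Bv => /=; rewrite mem_index_enum.
Qed.

Lemma setI_closed_tuple_rects d (H : measurableType d) (n : nat) :
  setI_closed (@tuple_rects d H n).
Proof.
move=> _ _ [B mB <-] [C mC <-]; exists (fun i => B i `&` C i).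
  by move=> i; exact: measurableI.
apply/seteqP; split => v /=; rewrite /tuple_rect /=.
  by move=> BC; split=> i; case: (BC i).
by move=> [Bv Cv] i; split.
Qed.

(** Integrate the pointwise inequality between indicators. *)
Lemma sum_measure_le d (T : measurableType d) (R : realType)
    (mu : {measure set T -> \bar R}) (I : Type) (s : seq I) (A : I -> set T)
    (B : set T) (k : R) :
  0 <= k -> (forall i, measurable (A i)) -> measurable B ->
  (forall x, \sum_(i <- s) \1_(A i) x <= k * \1_B x) ->
  (\sum_(i <- s) mu (A i) <= k%:E * mu B)%E.
Proof.
move=> k0 mA mB AB.
have mind C : measurable C ->
    measurable_fun [set: T] (fun x => (\1_C x : R)%:E).
  by move=> mC; apply/measurable_EFinP; exact: measurable_indic.
rewrite -[in leRHS](setIT B) -integral_indic//.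
rewrite -ge0_integralZl//; last exact: mind.
under eq_bigr do rewrite -[A _]setIT -integral_indic//.
rewrite -ge0_integral_sum//; last by move=> i; exact: mind.
apply: ge0_le_integral => //.
- by move=> x _; apply: sume_ge0 => i _; rewrite lee_fin.
- by apply: emeasurable_sum => i; exact: mind.
- by apply: measurable_funeM; exact: mind.
- by move=> x _; rewrite sumEFin -EFinM lee_fin.
Qed.

(** * Joint law of the hash values of distinct items *)

Section Hashing.
Context {R : realType} {d dH : measure_display}.
Context {T : measurableType d} {H : measurableType dH} {U : eqType}.
Variables (P : probability T R) (h : U -> {RV P >-> H}).

Definition hash_tuple (n : nat) (t : n.-tuple U) (r : T) : n.-tuple H :=
  [tuple of [seq h x r | x <- t]].

Lemma measurable_hash_tuple (n : nat) (t : n.-tuple U) :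
  measurable_fun setT (hash_tuple t).
Proof.
apply/measurable_fun_tnthP => i.
rewrite (_ : _ \o _ = h (tnth t i)); first exact: measurable_funPT.
by apply/funext => r /=; rewrite tnth_map.
Qed.

HB.instance Definition _ (n : nat) (t : n.-tuple U) :=
  isMeasurableFun.Build _ _ _ _ (hash_tuple t) (measurable_hash_tuple t).

(** Independence gives the product and uniformity its factors. The right side does not mention [t]:
    this is the source of exchangeability. *)
Lemma hash_tuple_rect (nu : {measure set H -> \bar R}) (n : nat)
    (t : n.-tuple U) (B : 'I_n -> set H) :
  uniform_hash nu h -> uniq t -> (forall i, measurable (B i)) ->
  P (hash_tuple t @^-1` tuple_rect B) =
  (\prod_(i < n) (nu (B i) * (fine (nu [set: H]))^-1%:E))%E.
Proof.
move=> [_ unif indep] ut mB.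
(* Independence takes sides indexed by items, not positions. As [t] has no repetition, the side at
   an item is read off at its index; the default [setT] keeps the sides at items outside [t]
   measurable. *)
pose B' (x : U) : set H := nth setT [seq B i | i <- enum 'I_n] (index x t).
have B'E i : B' (tnth t i) = B i.
  rewrite /B' (tnth_nth (tnth t i)) index_uniq ?size_tuple//.
  by rewrite (nth_map i) ?size_enum_ord// nth_ord_enum.
have mB' x : measurable (B' x).
  have [xt|xt] := boolP (x \in t).
    by have /tnthP[i ->] := xt; rewrite B'E.
  rewrite /B' nth_default// size_map size_enum_ord.
  by rewrite memNindex ?size_tuple.
rewrite (_ : _ @^-1` _ = [set r | forall x, x \in tval t -> B' x (h x r)]).
  rewrite indep// big_tuple; apply: eq_bigr => i _.
  by rewrite B'E unif.
apply/seteqP; split => r /= Br.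
  by move=> x /tnthP[i ->]; rewrite B'E; have := Br i; rewrite tnth_map.
by move=> i; rewrite tnth_map -B'E; apply: Br; exact: mem_tnth.
Qed.

(** The two laws are finite measures that agree on the pi-system of rectangles, hence everywhere. *)
Lemma hash_tuple_exchangeable (nu : {measure set H -> \bar R}) (n : nat)
    (t u : n.-tuple U) (C : set (n.-tuple H)) :
  uniform_hash nu h -> uniq t -> uniq u -> measurable C ->
  P (hash_tuple t @^-1` C) = P (hash_tuple u @^-1` C).
Proof.
move=> unif ut uu mC.
apply: (measure_unique (@tuple_rects dH H n) (fun=> setT)
  (measurable_tuple_rects H n) (@setI_closed_tuple_rects dH H n) _ _
  (distribution P (hash_tuple t)) (distribution P (hash_tuple u))) => //.
- by move=> _; exists (fun=> setT) => //; apply/seteqP.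
- by rewrite bigcup_const.
- by move=> _ [B mB <-]; rewrite /= /distribution /pushforward /=
    !(hash_tuple_rect unif).
- by move=> _; rewrite (le_lt_trans (probability_le1 _ _)) ?ltry.
Qed.

(** * Probabilities of states and of state changes *)

Section States.
Context {Omega : Type} (S : T -> seq U -> Omega).
Hypothesis hashS : hash_based_order_invariant h S.

Lemma measurable_state (D : seq U) (s : Omega) : measurable [set r | S r D = s].
Proof.
have [F [mF SF]] := hashS.
have := measurable_hash_tuple (in_tuple D) measurableT (mF _ s).
rewrite setTI; congr measurable; apply/seteqP; split => r /=.
  rewrite SF => <-; congr F; apply/seteqP; split => y /=.
    by move=> [x /= xD <-]; exact: map_f.
  by move=> /mapP[x xD ->]; exists x.
rewrite SF => <-; congr F; apply/seteqP; split => y /=.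
  by move=> /mapP[x xD ->]; exists x.
by move=> [x /= xD <-]; exact: map_f.
Qed.

Lemma state_changeE (D1 D2 : seq U) (s : Omega) :
  [set r | S r D1 <> S r D2 /\ S r D2 = s] =
  [set r | S r D2 = s] `\` [set r | S r D1 = s].
Proof. by apply/seteqP; split => r /= [] => [N <-|<- N]. Qed.

Lemma measurable_state_change (D1 D2 : seq U) (s : Omega) :
  measurable [set r | S r D1 <> S r D2 /\ S r D2 = s].
Proof.
by rewrite state_changeE; apply: measurableD; exact: measurable_state.
Qed.

Lemma prob_state_split (D1 D2 : seq U) (s : Omega) :
  fine (P [set r | S r D2 = s]) =
  fine (P [set r | S r D1 <> S r D2 /\ S r D2 = s]) +
  fine (P [set r | S r D1 = s /\ S r D2 = s]).
Proof.
have mS D := measurable_state D s.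
rewrite state_changeE (measureDI P (mS D2) (mS D1)).
rewrite fineD ?fin_num_measure//.
- by rewrite setIC.
- by apply: measurableD.
- by apply: measurableI.
Qed.

(** Each event is the preimage of one and the same set of hash vectors, under an enumeration of the
    distinct items of [D] that depends on the removed item. *)
Lemma state_change_exchangeable (nu : {measure set H -> \bar R}) (D : seq U)
    (i j : U) (s : Omega) :
  uniform_hash nu h -> i \in D -> j \in D ->
  P [set r | S r (remove_item i D) <> S r D /\ S r D = s] =
  P [set r | S r (remove_item j D) <> S r D /\ S r D = s].
Proof.
move=> unif iD jD; have [F [mF SF]] := hashS.
pose m := (num_distinct D).-1.
(* Listing x first makes the pair (D, D_{-x}) correspond to (v, behead v). *)
pose front x : seq U := x :: undup (remove_item x D).
have front_uniq x : uniq (front x).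
  by rewrite /= undup_uniq mem_undup mem_filter eqxx.
have mem_front x : x \in D -> front x =i D.
  move=> xD y; rewrite inE mem_undup mem_filter.
  by case: eqVneq => [->|].
have front_size x : x \in D -> size (front x) == m.+1.
  move=> xD; rewrite /m prednK ?(num_distinct_gt0 xD)//.
  rewrite /num_distinct; apply/eqP.
  apply: perm_size; apply: uniq_perm; rewrite ?front_uniq ?undup_uniq// => y.
  by rewrite mem_front// mem_undup.
have hash_set (D1 D2 : seq U) r : D1 =i D2 ->
    [set h x r | x in [set` D1]] = [set` [seq h x r | x <- D2]].
  move=> D12; apply/seteqP; split => y /=.
    by move=> [x /=]; rewrite D12 => xD <-; exact: map_f.
  by move=> /mapP[x xD ->]; exists x => //=; rewrite D12.
(* The full vector yields state [s], its tail does not; no item is mentioned, so [C] serves both [i]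
   and [j]. *)
pose C : set (m.+1.-tuple H) := [set v | F [set` v] = s] `\`
  (fun v : m.+1.-tuple H => [tuple of behead v]) @^-1`
    [set v : m.-tuple H | F [set` v] = s].
have mC : measurable C.
  apply: measurableD; first exact: mF.
  rewrite -[X in measurable X]setTI.
  exact: (@measurable_behead _ H m measurableT _ (mF _ _)).
have event x (xD : x \in D) :
    [set r | S r (remove_item x D) <> S r D /\ S r D = s] =
    hash_tuple (Tuple (front_size x xD)) @^-1` C.
  have SD r : S r D = F [set` [seq h y r | y <- front x]].
    by rewrite SF (hash_set _ (front x))// => y; rewrite mem_front.
  have SDx r : S r (remove_item x D) =
      F [set` behead [seq h y r | y <- front x]].
    rewrite SF (hash_set _ (undup (remove_item x D)))// => y.
    by rewrite mem_undup.
  by apply/seteqP; split => r; rewrite /C /= SDx SD;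
    [move=> [N <-]|move=> [<- N]].
rewrite !event.
by apply: (hash_tuple_exchangeable unif) => //; exact: front_uniq.
Qed.

(** Exchangeability turns the left side into the sum over distinct [j] of the probabilities of the
    events [A j]. An [r] with [S r D = s] lies in exactly [num_changing S D r] of them, any other
    [r] in none. *)
Lemma state_change_prob_le (nu : {measure set H -> \bar R}) (D : seq U)
    (i : U) (s : Omega) (kmax : R) :
  uniform_hash nu h -> i \in D ->
  (forall r, (num_changing S D r)%:R <= kmax) ->
  ((num_distinct D)%:R%:E *
    P [set r | S r (remove_item i D) <> S r D /\ S r D = s] <=
   kmax%:E * P [set r | S r D = s])%E.
Proof.
move=> unif iD Kle; have k0 : 0 <= kmax by exact: le_trans (Kle point).
pose A j := [set r | S r (remove_item j D) <> S r D /\ S r D = s].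
have -> : ((num_distinct D)%:R%:E * P (A i) = \sum_(j <- undup D) P (A j))%E.
  rewrite /num_distinct -sum1_size natr_sum -sumEFin ge0_sume_distrl//.
  rewrite !big_seq; apply: eq_bigr => j; rewrite mem_undup => jD.
  by rewrite mul1e; exact: state_change_exchangeable unif iD jD.
apply: sum_measure_le => //.
- by move=> j; exact: measurable_state_change.
- exact: measurable_state.
move=> r; have [Ds|Ds] := pselect (S r D = s).
  rewrite indicE mem_set// mulr1; apply: le_trans (Kle r).
  rewrite /num_changing /changing_items size_filter -sum1_count natr_sum.
  rewrite [leRHS]big_mkcond/=; apply: ler_sum => j _.
  rewrite indicE; case: asboolP => N; first by rewrite lern1 leq_b1.
  by rewrite memNset//= => -[].
rewrite big1 ?mulr_ge0// => j _.
by rewrite indicE memNset//= => -[].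
Qed.

End States.
End Hashing.

(** * From the two loss estimates to the bounds on the likelihood ratio *)

Theorem theorem1 (R : realType) (d dH : measure_display)
    (T : measurableType d) (H : measurableType dH) (P : probability T R)
    (U : eqType) (Omega : Type) (nu : {measure set H -> \bar R})
    (h : U -> {RV P >-> H}) (S : T -> seq U -> Omega)
    (eps kmax : R) (n : nat) :
  uniform_hash nu h ->
  hash_based_order_invariant h S ->
  0 < eps ->
  (forall (D : seq U) (r : T), (num_changing S D r)%:R <= kmax) ->
  (forall (D : seq U) (i : U), num_distinct D = n -> i \in D ->
     sup [set change_prob P S D i s | s in [set: Omega]] < 1 - expR (- eps)) ->
  kmax / (1 - expR (- eps)) < n%:R ->
  eps_DP P S n eps.
Proof.
move=> unif hashS eps0 Kle piS nlt D i s Dn iD p q pq0.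
pose Di := remove_item i D.
have mS D' s' : measurable [set r | S r D' = s'].
  exact: measurable_state hashS _ _.
have mC D1 D2 s' : measurable [set r | S r D1 <> S r D2 /\ S r D2 = s'].
  exact: measurable_state_change hashS _ _ _.
pose a := fine (P [set r | S r Di <> S r D /\ S r D = s]).
(* [b] and [c] stay functions of the state because the supremum below ranges over all states. *)
pose b s := fine (P [set r | S r D <> S r Di /\ S r Di = s]).
pose c s := fine (P [set r | S r Di = s /\ S r D = s]).
have c0 s' : 0 <= c s' by rewrite fine_ge0.
have b0 s' : 0 <= b s' by rewrite fine_ge0.
have pE : p = a + c s by exact: prob_state_split hashS _ _ _.
have qE s' : fine (P [set r | S r Di = s']) = b s' + c s'.
  rewrite (prob_state_split hashS D Di s'); congr (_ + fine (P _)).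
  by apply/seteqP; split => r /= [].
have e1 : expR (- eps) < 1 by rewrite expR_lt1 oppr_lt0.
have a_le : n%:R * a <= kmax * p.
  have := state_change_prob_le hashS s unif iD (Kle D).
  by rewrite Dn -/Di -lee_fin !EFinM !fineK// fin_num_measure.
have b_le : b s <= (b s + c s) *
    sup [set change_prob P S D i s | s in [set: Omega]].
  have [bc0|bc0] := eqVneq (b s + c s) 0.
    by rewrite bc0 mul0r -bc0 lerDl.
  have bcgt0 : 0 < b s + c s by rewrite lt0r bc0 addr_ge0.
  rewrite mulrC -ler_pdivrMr//; apply: ub_le_sup.
    (* A real [sup] dominates its set only if the set is bounded above; 1 bounds every
       [b / (b + c)], also under division by zero. *)
    exists 1 => _ [s' _ <-]; rewrite /change_prob -/Di qE -/(b s').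
    have [->|bc0'] := eqVneq (b s' + c s') 0; first by rewrite invr0 mulr0.
    by rewrite ler_pdivrMr ?mul1r ?lerDl// lt0r bc0' addr_ge0.
  by exists s => //; rewrite /change_prob -/Di qE.
have sup_lt := piS D i Dn iD.
set sigma := sup _ in b_le sup_lt.
have e0 : 0 < expR (- eps) by exact: expR_gt0.
rewrite ltr_pdivrMr ?subr_gt0// in nlt.
have q_sE : q = b s + c s by exact: qE.
have a0 : 0 <= a by rewrite fine_ge0.
have p0 : 0 <= p by rewrite fine_ge0.
have sup_lt1 : sigma < 1 by apply: lt_trans sup_lt _; rewrite ltrBlDr ltrDl.
have kmax_lt : kmax < n%:R.
  by apply: lt_le_trans nlt _; rewrite ler_piMr// lerBlDr lerDl ltW.
(* [c s = 0] forces [a = b s = 0], excluded by [pq0]. *)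
have c_pos : 0 < c s.
  rewrite lt0r c0 andbT; apply: contraTneq pq0 => c_eq0.
  rewrite negb_or !negbK pE q_sE c_eq0 !addr0; apply/andP; split.
    rewrite eq_le a0 andbT leNgt; apply/negP => a_gt0.
    by move: a_le; rewrite pE c_eq0 addr0 ler_pM2r// leNgt kmax_lt.
  rewrite eq_le b0 andbT leNgt; apply/negP => b_gt0.
  by move: b_le; rewrite c_eq0 addr0 ler_pMr// leNgt sup_lt1.
have p_pos : 0 < p by rewrite pE ltr_wpDl.
have q_pos : 0 < q by rewrite q_sE ltr_wpDl.
have lower : q * expR (- eps) < p.
  have : q * expR (- eps) < q * (1 - sigma).
    by rewrite ltr_pM2l// ltrBrDl -ltrBrDr.
  (* Here [p >= c s = q - b s >= q * (1 - sigma)]. *)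
  rewrite -q_sE in b_le; nra.
have upper : p * expR (- eps) < q.
  have n0 : 0 < n%:R :> R by rewrite ltr0n -Dn (num_distinct_gt0 iD).
  have : n%:R * a < n%:R * ((1 - expR (- eps)) * p).
    by rewrite mulrA; apply: le_lt_trans a_le _; rewrite ltr_pM2r.
  (* From [a < (1 - expR (- eps)) * p] follows [q >= c s = p - a > p * expR (- eps)]. *)
  rewrite ltr_pM2l// => alt; have := b0 s; nra.
rewrite ltr_pdivlMr// ltr_pdivrMr// mulrC lower/=.
(* Multiplying [p < expR eps * q] by [expR (- eps)] gives [upper]. *)
by rewrite -(ltr_pM2r e0) mulrAC -expRD subrr expR0 mul1r.
Qed.
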